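(* Consider the three families of solutions of degree $5$ and size $6$ of the two-dimensional Prouhet--Tarry--Escott problem with rational parameters given in the context: the Alpers--Tijdeman family $\mathrm{AT}(a,b)$, the two-dimensional Borwein family $\mathrm{B}(m,n)$, and the family $\mathrm{E}(t_1,t_2)$. Then the Alpers--Tijdeman solution is equivalent to the two-dimensional Borwein solution over $\mathbb{Q}$, that is, the family $\mathrm{AT}$ contains the family $\mathrm{B}$ over $\mathbb{Q}$ and the family $\mathrm{B}$ contains the family $\mathrm{AT}$ over $\mathbb{Q}$. In particular, both families $\mathrm{AT}$ and $\mathrm{B}$ contain the family $\mathrm{E}$ over $\mathbb{Q}$.
   Context: A (rational) solution of degree $5$ and size $6$ of the two-dimensional PTE problem is an ordered pair of disjoint multisets $[\mathbf a_1,\dots,\mathbf a_6]=_5[\mathbf b_1,\dots,\mathbf b_6]$ of points of $\mathbb{Q}^2$ with $\sum_i a_{i1}^{k_1}a_{i2}^{k_2}=\sum_i b_{i1}^{k_1}b_{i2}^{k_2}$ for all $k_1,k_2\ge0$, $1\le k_1+k_2\le5$. A solution $[\mathbf a_i]=_5[\mathbf b_i]$ contains a solution $[\mathbf c_i]=_5[\mathbf d_i]$ over $\mathbb{Q}$ if there exist $M\in M_2(\mathbb{Q})$ and $\mathbf e\in\mathbb{Q}^2$ such that $\{\mathbf a_iM+\mathbf e\}=\{\mathbf c_i\}$ and $\{\mathbf b_iM+\mathbf e\}=\{\mathbf d_i\}$ as multisets (points are row vectors). A parametric family $\mathcal{S}$ contains a parametric family $\mathcal{T}$ over $\mathbb{Q}$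 if for every choice of rational parameters for which the member of $\mathcal{T}$ is a genuine solution (its two multisets are disjoint) there is a choice of rational parameters of $\mathcal{S}$ giving a solution that contains that member of $\mathcal T$ over $\mathbb{Q}$. Two families are equivalent over $\mathbb{Q}$ if they contain each other. Families ($\pm$ means that both signs are taken): $\mathrm{AT}(a,b)$, $a,b\in\mathbb{Q}$: $[(0,0),(2a+b,b),(3a+b,3a+3b),(2a,6a+4b),(-b,6a+3b),(-a-b,3a+b)]$ $=_5[(2a,0),(3a+b,3a+b),(2a+b,6a+3b),(0,6a+4b),(-a-b,3a+3b),(-b,b)]$. $\mathrm{B}(m,n)$, $m,n\in\mathbb{Q}$: $[\pm(x_1,x_2),\pm(x_2,x_3),\pm(x_3,x_1)]=_5[\pm(y_1,y_2),\pm(y_2,y_3),\pm(y_3,y_1)]$ with $x_1=2(n+m)$, $x_2=-nm-n-m+3$, $x_3=nm-n-m-3$, $y_1=2(n-m)$, $y_2=nm-n+m+3$, $y_3=-nm-n+m-3$. $\mathrm{E}(t_1,t_2)$, $t_1,t_2\in\mathbb{Q}$: $[X_{t_1}]=_5[X_{t_2}]$, where $X_t$ consists of the six points $\pm\big(\frac{2t+1}{t^2+t+1},\frac{t^2-1}{t^2+t+1}\big)$, $\pm\big(\frac{t^2-1}{t^2+t+1},-\frac{t(t+2)}{t^2+t+1}\big)$, $\pm\big(-\frac{t(t+2)}{t^2+t+1},\frac{2t+1}{t^2+t+1}\big)$. *)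

(* Defs.v *)
From mathcomp Require Import all_boot all_order all_algebra.
Set Implicit Arguments. Unset Strict Implicit. Unset Printing Implicit Defensive.
Import Order.TTheory GRing.Theory Num.Theory.
Local Open Scope ring_scope.

Definition point := 'rV[rat]_2.

Definition pt (x y : rat) : point := \row_(j < 2) [:: x; y]`_j.

(* A multiset of six points is a 6-tuple taken up to perm_eq. *)
Definition six := 6.-tuple point.

Definition moment (k1 k2 : nat) (A : six) : rat :=
  \sum_(p <- A) p 0 0 ^+ k1 * p 0 1 ^+ k2.

Definition disjoint_multisets (A B : six) : Prop :=
  forall p : point, p \in A -> p \notin B.

Definition is_solution (s : six * six) : Prop :=
  disjoint_multisets s.1 s.2 /\
  forall k1 k2 : nat, (1 <= k1 + k2 <= 5)%N ->
    moment k1 k2 s.1 = moment k1 k2 s.2.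

Definition affine_image (M : 'M[rat]_2) (e : point) (A : six) : six :=
  [tuple of [seq p *m M + e | p <- A]].

Definition solution_contains (s t : six * six) : Prop :=
  exists (M : 'M[rat]_2) (e : point),
    perm_eq (affine_image M e s.1) t.1 /\ perm_eq (affine_image M e s.2) t.2.

Definition family := rat -> rat -> six * six.

(* Only disjointness is asked of the member of T: its moment equations are
   inherited, through the affine map, from the solution in S containing it. *)
Definition family_contains (S T : family) : Prop :=
  forall u v : rat, disjoint_multisets (T u v).1 (T u v).2 ->
    exists a b : rat, is_solution (S a b) /\ solution_contains (S a b) (T u v).

Definition family_equivalent (S T : family) : Prop :=
  family_contains S T /\ family_contains T S.

Definition AT : family := fun a b =>
  ([tuple pt 0 0;
          pt (2 * a + b) b;
          pt (3 * a + b) (3 * a + 3 * b);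
          pt (2 * a) (6 * a + 4 * b);
          pt (- b) (6 * a + 3 * b);
          pt (- a - b) (3 * a + b)],
   [tuple pt (2 * a) 0;
          pt (3 * a + b) (3 * a + b);
          pt (2 * a + b) (6 * a + 3 * b);
          pt 0 (6 * a + 4 * b);
          pt (- a - b) (3 * a + 3 * b);
          pt (- b) b]).

(* The points +-(x1, x2), +-(x2, x3), +-(x3, x1). *)
Definition cyclic_pm (x1 x2 x3 : rat) : six :=
  [tuple pt x1 x2; - pt x1 x2; pt x2 x3; - pt x2 x3; pt x3 x1; - pt x3 x1].

Definition Bor : family := fun m n =>
  let x1 := 2 * (n + m) in
  let x2 := - (n * m) - n - m + 3 in
  let x3 := n * m - n - m - 3 in
  let y1 := 2 * (n - m) in
  let y2 := n * m - n + m + 3 in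
  let y3 := - (n * m) - n + m - 3 in
  (cyclic_pm x1 x2 x3, cyclic_pm y1 y2 y3).

Definition X (t : rat) : six :=
  let d := t ^+ 2 + t + 1 in
  cyclic_pm ((2 * t + 1) / d) ((t ^+ 2 - 1) / d) (- (t * (t + 2)) / d).

Definition Efam : family := fun t1 t2 => (X t1, X t2).

(* Main.v *)
Require Import Defs.
From mathcomp Require Import all_boot all_order all_algebra.
From mathcomp Require Import ring.

(**
  The linear isomorphism (x, y) |-> y + x sqrt(-3) onto K = Q(sqrt(-3)) turns
  the centred multisets of AT(a, b) into the orbits of p and of its conjugate
  p', with p = 3a + 2b + a sqrt(-3), under the six units of Z[w],
  w = (-1 + sqrt(-3)) / 2. Under the linear isomorphism
  (2s, -s - r) |-> r + s sqrt(-3), those of B(m, n) are the orbits of A * C and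
  A * C', with A = n + sqrt(-3) and C = m + sqrt(-3), and those of E(t1, t2)
  are the orbits of (t - w) / (t - w') for t = t1, t2.
  Hence B(m, n) is A times the AT solution with p = C; every AT solution with
  a <> 0 is, up to scaling, the image of B(m, 0) under division by sqrt(-3);
  and E(t1, t2) is the AT solution with p = (t1 - w)(t2 - w') divided by
  (t1 - w')(t2 - w').
*)

Set Implicit Arguments. Unset Strict Implicit. Unset Printing Implicit Defensive.
Import Order.TTheory GRing.Theory Num.Theory.
Local Open Scope ring_scope.

Lemma pt0 x y : pt x y 0 0 = x. Proof. by rewrite mxE. Qed.

Lemma pt1 x y : pt x y 0 1 = y. Proof. by rewrite mxE. Qed.

Lemma opp_pt x y : - pt x y = pt (- x) (- y).
Proof. by apply/rowP=> -[[|[|//]] ?]; rewrite !mxE. Qed.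

Definition mat2 (a b c d : rat) : 'M[rat]_2 :=
  \matrix_(i < 2, j < 2) (if i == 0 then pt a b else pt c d) 0 j.

Lemma pt_affine x y a b c d e f :
  pt x y *m mat2 a b c d + pt e f = pt (x * a + y * c + e) (x * b + y * d + f).
Proof.
apply/rowP=> -[[|[|//]] ?];
  by rewrite !mxE !big_ord_recl big_ord0 !mxE /= addr0.
Qed.

Lemma pt_eq x y x' y' : x = x' -> y = y' -> pt x y = pt x' y'.
Proof. by move=> -> ->. Qed.

(** An explicit index list [r] certifies the matching of points, leaving coordinatewise identities
    for [field]. *)
Lemma perm_map_nth (T : eqType) (x0 : T) (s t : seq T) (r : seq nat) :
  perm_eq r (iota 0 (size t)) -> s = [seq nth x0 t i | i <- r] -> perm_eq s t.
Proof.
by move=> rP ->; rewrite -[X in perm_eq _ X](mkseq_nth x0) perm_map.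
Qed.

Lemma affine_imageM M e N f A :
  affine_image N f (affine_image M e A) =
  affine_image (M *m N) (e *m N + f) A :> seq point.
Proof.
rewrite /= -map_comp; apply: eq_map => p /=.
by rewrite mulmxDl mulmxA addrA.
Qed.

Lemma solution_contains_trans s t u :
  solution_contains s t -> solution_contains t u -> solution_contains s u.
Proof.
move=> [M [e [st1 st2]]] [N [f [tu1 tu2]]].
exists (M *m N), (e *m N + f); rewrite -!affine_imageM.
by split; [apply: perm_trans tu1 | apply: perm_trans tu2]; apply: perm_map.
Qed.

(** The affine map sends a common point of [s] to a common point of [t]. *)
Lemma solution_contains_disjoint s t : solution_contains s t ->
  disjoint_multisets t.1 t.2 -> disjoint_multisets s.1 s.2.
Proof.
move=> [M [e [st1 st2]]] dis p p1; apply/negP=> p2.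
have fA (A : six) : p \in A -> p *m M + e \in affine_image M e A.
  by move=> pA; apply/mapP; exists p.
have := fA _ p1; rewrite (perm_mem st1) => /dis/negP; apply.
by rewrite -(perm_mem st2) fA.
Qed.

Lemma family_contains_trans S T U :
  family_contains S T -> family_contains T U -> family_contains S U.
Proof.
move=> ST TU u v /TU[c [d [[dis _] cdU]]].
have [a [b [abS abT]]] := ST c d dis.
by exists a, b; split=> //; apply: solution_contains_trans cdU.
Qed.

Definition moments_agree (s : six * six) :=
  forall k1 k2 : nat, (1 <= k1 + k2 <= 5)%N ->
    moment k1 k2 s.1 = moment k1 k2 s.2.

Lemma moments_AT a b : moments_agree (AT a b).
Proof.
move=> k1 k2; rewrite /moment !big_cons !big_nil !pt0 !pt1.
by case: k1 => [|[|[|[|[|[|//]]]]]]; case: k2 => [|[|[|[|[|[|//]]]]]] // _; ring.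
Qed.

Lemma moments_Bor m n : moments_agree (Bor m n).
Proof.
move=> k1 k2; rewrite /moment !big_cons !big_nil !opp_pt !pt0 !pt1.
by case: k1 => [|[|[|[|[|[|//]]]]]]; case: k2 => [|[|[|[|[|[|//]]]]]] // _; ring.
Qed.

Lemma is_solution_contains s t : moments_agree s -> solution_contains s t ->
  disjoint_multisets t.1 t.2 -> is_solution s /\ solution_contains s t.
Proof.
move=> ms st dt; split=> //; split=> //.
exact: solution_contains_disjoint dt.
Qed.

Lemma AT_contains_Bor : family_contains AT Bor.
Proof.
(* With [a = 1], this [b] solves [3a + 2b = m], so that p = C. *)
move=> m n dis; exists 1, ((m - 3) / 2).
apply: is_solution_contains dis; first exact: moments_AT.
(* Multiplication by A, read from the AT coordinates to those of B; the translation first moves the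
   AT centre [(1, m)] to the origin. *)
exists (mat2 (2 * n) (3 - n) 2 (- 1 - n)).
exists (pt (- (2 * n + 2 * m)) (n - 3 + m * (1 + n))).
split; [apply: (@perm_map_nth _ 0 _ _ [:: 1; 4; 3; 0; 5; 2]%N) |
        apply: (@perm_map_nth _ 0 _ _ [:: 0; 5; 2; 1; 4; 3]%N)] => //=;
  rewrite !opp_pt !pt_affine.
all: by do !congr (_ :: _); apply: pt_eq; field.
Qed.

(** At [a = 0] the point [(2a, 0)] falls on the origin, which lies in the other multiset. *)
Lemma AT_0_not_disjoint b : ~ disjoint_multisets (AT 0 b).1 (AT 0 b).2.
Proof.
by move/(_ (pt 0 0)); rewrite !inE mulr0 eqxx /= => /(_ isT).
Qed.

Lemma Bor_contains_AT : family_contains Bor AT.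
Proof.
move=> a b dis.
have a_neq0 : a != 0.
  by apply/eqP=> a0; apply: (@AT_0_not_disjoint b); rewrite -a0.
(* Here C = p / [a] and A = sqrt(-3), so the map below multiplies by [a] / sqrt(-3) and adds the AT
   centre. *)
exists ((3 * a + 2 * b) / a), 0.
apply: is_solution_contains dis; first exact: moments_Bor.
exists (mat2 (a / 6) (a / 2) (a / 3) 0), (pt a (3 * a + 2 * b)).
split; [apply: (@perm_map_nth _ 0 _ _ [:: 3; 0; 5; 2; 1; 4]%N) |
        apply: (@perm_map_nth _ 0 _ _ [:: 0; 3; 2; 5; 4; 1]%N)] => //=;
  rewrite !opp_pt !pt_affine.
all: by do !congr (_ :: _); apply: pt_eq; field.
Qed.

Lemma X_denominator_neq0 (t : rat) : t ^+ 2 + t + 1 != 0.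
Proof.
have -> : t ^+ 2 + t + 1 = (t + 1 / 2) ^+ 2 + 3 / 4 by field.
by rewrite gt_eqF // ltr_wpDl // sqr_ge0.
Qed.

Lemma AT_contains_Efam : family_contains AT Efam.
Proof.
(* Solves p = (t - w)(u - w'): [a] is the coefficient of sqrt(-3) and [3a + 2b] the rational
   part. *)
move=> t u dis; exists ((t - u) / 2), ((t * u + 1 - t + 2 * u) / 2).
apply: is_solution_contains dis; first exact: moments_AT.
have t0 := X_denominator_neq0 t; have u0 := X_denominator_neq0 u.
pose D := (t ^+ 2 + t + 1) * (u ^+ 2 + u + 1).
(* [g + h sqrt(-3)] is [(t - w)(u - w)], that is, [D / ((t - w')(u - w'))];
   [(q, r)] is the centre of AT. *)
pose h := - (t + u + 1) / 2; pose g := t * u - 1 - h.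
pose q := (t - u) / 2; pose r := t * u + 1 + (t + u) / 2.
exists (mat2 (2 * g / D) ((3 * h - g) / D) (2 * h / D) ((- h - g) / D)).
exists (pt (- (q * (2 * g) + r * (2 * h)) / D)
           (- (q * (3 * h - g) + r * (- h - g)) / D)).
split; apply: (@perm_map_nth _ 0 _ _ [:: 0; 5; 2; 1; 4; 3]%N) => //=;
  rewrite !opp_pt !pt_affine /q /r /g /h /D.
all: by do !congr (_ :: _); apply: pt_eq; field; rewrite ?t0 ?u0.
Qed.

Theorem theorem5p6 :
  family_equivalent AT Bor /\ family_contains AT Efam /\ family_contains Bor Efam.
Proof.
split; first by split; [exact: AT_contains_Bor | exact: Bor_contains_AT].
split; first exact: AT_contains_Efam.
exact: family_contains_trans Bor_contains_AT AT_contains_Efam.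
Qed.
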